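(* Let $n\ge 2$ and let $\pi=(\pi_1,\ldots,\pi_n)^{\rm T}$ be any positive probability vector, i.e. $\pi_i>0$ for all $i$ and $\sum_{i=1}^n\pi_i=1$. Then there exists a (nonempty) family of weighted Hamiltonian cycles of the form $n\to(n-1)\to\cdots\to 2\to 1\to n$ with loops such that each member $H$ of the family is the communication digraph of a row stochastic influence matrix $P_H$, and using $H$ as the communication digraph in DeGroot's method implements the consensus $\bar s=\pi^{\rm T}s(0)$ for any vector of initial opinions $s(0)\in\mathbb{R}^n$; that is, $$\lim_{k\to\infty}P_H^k\,s(0)=\bigl(\pi^{\rm T}s(0)\bigr)\,(1,\ldots,1)^{\rm T}\quad\text{for every } s(0)\in\mathbb{R}^n .$$ Moreover, in each such cycle $H$ of the family, the weight of the (non-loop) arc entering vertex $k$ is proportional to $\pi_k^{-1}$: there is a constant $c=c(H)>0$ such that for every $k=1,\ldots,n$ the weight of the non-loop arc entering vertex $k$ equals $c\,\pi_k^{-1}$.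
   Context: DeGroot's method: given a row stochastic $n\times n$ matrix $P=(p_{ij})$ (the influence matrix: nonnegative entries, each row summing to $1$) and a vector of initial opinions $s(0)\in\mathbb{R}^n$, the opinions after step $k$ are $s(k)=Ps(k-1)$, i.e. $s(k)=P^ks(0)$, $k=1,2,\ldots$. A consensus $\bar s\in\mathbb{R}$ is (asymptotically) reached if $\lim_{k\to\infty}s_i(k)=\bar s$ for all $i\in\{1,\ldots,n\}$. Communication digraph: with a stochastic influence matrix $P$ one associates the weighted digraph with vertex set $\{1,\ldots,n\}$ that has an arc $(j,i)$ (from $j$ to $i$) of weight $w_{ji}=p_{ij}$ exactly when $p_{ij}>0$; loops $(i,i)$ of weight $p_{ii}$ are included when $p_{ii}>0$. Thus arcs are oriented in the direction of influence. A weighted Hamiltonian cycle of the form $n\to(n-1)\to\cdots\to 2\to 1\to n$ with loops is a digraph on the vertex set $\{1,\ldots,n\}$ with positive arc weights whose non-loop arcs are exactly $(k+1,k)$ for $k=1,\ldots,n-1$ and $(1,n)$, and which in addition has loops (at one or more vertices). Hence it is the communication digraph of a stochastic matrix $P_H$ exactly when, for each vertex $k$, the weight $x_k$ of the non-loop arc entering $k$ satisfies $0<x_k\le 1$ and the loop at $k$ has weight $1-x_k$ (the loop being absent when $x_k=1$); then $(P_H)_{k,k+1}=x_k$ for $k<n$, $(P_H)_{n,1}=x_n$, $(P_H)_{kk}=1-x_k$, and all other entries are $0$. *)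

(* Defs.v *)
From HB Require Import structures.
From mathcomp Require Import all_boot all_order all_algebra.
From mathcomp Require Import all_classical all_reals all_analysis.
Set Implicit Arguments.
Unset Strict Implicit.
Unset Printing Implicit Defensive.
Import Order.TTheory GRing.Theory Num.Theory.
Import numFieldNormedType.Exports.
Local Open Scope classical_set_scope.
Local Open Scope ring_scope.

(* The vertex called k in 1..n is the ordinal of value k - 1. *)

(* [has_arc H j i]: there is an arc from j to i; the value [arc_weight H j i]
   is meaningful only in that case. *)
Record wdigraph (R : realType) (n : nat) := WDigraph {
  has_arc : rel 'I_n ;
  arc_weight : 'I_n -> 'I_n -> R
}.

Definition row_stochastic (R : realType) (n : nat) (P : 'M[R]_n) : Prop :=
  (forall i j, 0 <= P i j) /\ (forall i, \sum_(j < n) P i j = 1).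

(* Arcs follow the direction of influence: the entry (i, j) of P is carried by
   the arc from j to i. *)
Definition communication_digraph (R : realType) (n : nat) (P : 'M[R]_n)
    (H : wdigraph R n) : Prop :=
  (forall j i, has_arc H j i = (0 < P i j)) /\
  (forall j i, has_arc H j i -> arc_weight H j i = P i j).

Definition opinions (R : realType) (n : nat) (P : 'M[R]_n) (s0 : 'cV[R]_n)
    (k : nat) : 'cV[R]_n := P ^+ k *m s0.

Definition reaches_consensus (R : realType) (n : nat) (P : 'M[R]_n)
    (s0 : 'cV[R]_n) (sbar : R) : Prop :=
  forall i : 'I_n, opinions P s0 k i 0 @[k --> \oo] --> sbar.

Definition implements_consensus (R : realType) (n : nat) (P : 'M[R]_n)
    (p : 'cV[R]_n) : Prop :=
  forall s0 : 'cV[R]_n, reaches_consensus P s0 ((p^T *m s0) 0 0).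

Definition positive_probability_vector (R : realType) (n : nat)
    (p : 'cV[R]_n) : Prop :=
  (forall i, 0 < p i 0) /\ \sum_(i < n) p i 0 = 1.

(* The cycle n -> n-1 -> ... -> 2 -> 1 -> n, with a loop at one vertex or more.
   With vertices numbered from 0, its non-loop arcs are (i + 1, i) and (0, n - 1). *)
Definition hamiltonian_cycle_with_loops (R : realType) (n : nat)
    (H : wdigraph R n) : Prop :=
  [/\ forall j i, has_arc H j i -> 0 < arc_weight H j i,
      forall j i : 'I_n, j != i ->
        has_arc H j i = (val j == (val i).+1)
                    || ((val j == 0%N) && (val i == n.-1))
    & exists i, has_arc H i i].

(* Main.v *)
Require Import Defs.
From HB Require Import structures.
From mathcomp Require Import all_boot all_order all_algebra.
From mathcomp Require Import all_classical all_reals all_analysis.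
From mathcomp Require Import lra zify.
Set Implicit Arguments.
Unset Strict Implicit.
Unset Printing Implicit Defensive.
Import Order.TTheory GRing.Theory Num.Theory.
Import numFieldNormedType.Exports.
Local Open Scope classical_set_scope.
Local Open Scope ring_scope.

(* The family consists of all admissible cycles, so proportionality must hold
   for each of them: comparing the limits along P^k (P s) and P^(k+1) s, the
   consensus vector satisfies p^T P = p^T, and on a cycle the column of vertex
   k of this equation says that p_k x_k equals p_(k+1) x_(k+1).
   Conversely, take x_k = c / p_k with c < min p. Then p^T P = p^T, and the
   energy sum_k p_k s_k^2 drops at each step by
   sum_k c (1 - x_k) (s_k - s_(k+1))^2. The energy converges, hence the
   differences of consecutive opinions tend to 0; as p^T s is conserved, all
   opinions tend to p^T s(0). *)

(** Turns the two-case description of non-loop arcs in [hamiltonian_cycle_with_loops] into one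
    cyclic successor: the arc entering [i] comes from [ordS i]. *)
Lemma ordS_eqE (n : nat) (i j : 'I_n) :
  (j == ordS i) = (val j == (val i).+1) || ((val j == 0%N) && (val i == n.-1)).
Proof.
rewrite -val_eqE /=; have lt_i := ltn_ord i; have lt_j := ltn_ord j.
have [lt_Si|le_n] := ltnP i.+1 n; first by rewrite modn_small //; lia.
have -> : i.+1 = n by lia.
rewrite modnn; lia.
Qed.

Lemma ordS_neq (n : nat) (i : 'I_n) : (1 < n)%N -> ordS i != i.
Proof. by move=> lt_1n; rewrite eq_sym ordS_eqE; case: i => i lt_i /=; lia. Qed.

Lemma ordS_ind (n : nat) (Q : 'I_n -> Prop) (i0 : 'I_n) :
  Q i0 -> (forall i, Q i -> Q (ordS i)) -> forall i, Q i.
Proof.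
move=> Q0 QS i.
have valE k : val (iter k (@ordS n) i0) = ((i0 + k) %% n)%N.
  elim: k => [|k IHk] /=; first by rewrite addn0 modn_small.
  by rewrite IHk -addn1 modnDml addn1 addnS.
(* From [i0], the first [n - i0] steps wrap around to 0, and [i] more lead to [i]. *)
suff -> : i = iter (n - i0 + i)%N (@ordS n) i0 by elim: (_ + _)%N => //= k /QS.
apply: val_inj; rewrite valE addnA subnKC; last exact: ltnW.
by rewrite modnDl modn_small.
Qed.

Section CycleMatrix.
Variables (R : realType) (n : nat).
Implicit Types (x : 'I_n -> R) (s p : 'cV[R]_n) (P : 'M[R]_n).

(* As a sum of a diagonal and a shift, so that for n = 1 the two contributions
   to the single entry add up. *)
Definition cycle_mx x : 'M[R]_n :=
  \matrix_(i, j) ((1 - x i) *+ (j == i) + x i *+ (j == ordS i)).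

Lemma cycle_mxE x s i :
  (cycle_mx x *m s) i 0 = (1 - x i) * s i 0 + x i * s (ordS i) 0.
Proof.
rewrite mxE; under eq_bigr do rewrite mxE mulrDl !mulrnAl !mulrb.
by rewrite big_split /= -!big_mkcond !big_pred1_eq.
Qed.

(** The column is indexed by [ordS j] because its contributions come from row [ordS j], through the
    loop, and row [j], through the arc. *)
Lemma trmx_mul_cycle_mxE x j p :
  (p^T *m cycle_mx x) 0 (ordS j)
  = p (ordS j) 0 * (1 - x (ordS j)) + p j 0 * x j.
Proof.
rewrite mxE; under eq_bigr do rewrite !mxE mulrDr !mulrnAr !mulrb.
rewrite big_split /= -!big_mkcond /=; congr (_ + _).
  by under eq_bigl do rewrite eq_sym; rewrite big_pred1_eq.
by under eq_bigl do rewrite (inj_eq (@ordS_inj n)) eq_sym; rewrite big_pred1_eq.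
Qed.

Lemma opinionsS P s k : opinions P s k.+1 = P *m opinions P s k.
Proof. by rewrite /opinions exprS -mulmxA. Qed.

Lemma implements_consensus_invariant P p :
  implements_consensus P p -> p^T *m P = p^T.
Proof.
move=> consP; apply/matrixP => i0 j; rewrite (ord1 i0).
have eq_lim s : (p^T *m (P *m s)) 0 0 = (p^T *m s) 0 0.
  have /cvg_unique := consP (P *m s) j; apply => //.
  have := consP s j; rewrite -(cvg_shiftS (fun k => opinions P s k j 0)).
  apply: cvg_trans; apply: near_eq_cvg; near=> k.
  by rewrite /= /opinions exprSr -mulmxA.
(* Basis vectors as initial opinions read off the coordinates. *)
by have := eq_lim (delta_mx j 0); rewrite mulmxA -!colE !mxE.
Unshelve. all: by end_near. Qed.

Lemma invariant_opinions P p s k :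
  p^T *m P = p^T -> p^T *m opinions P s k = p^T *m s.
Proof.
move=> pP; elim: k => [|k IHk]; first by rewrite /opinions expr0 mul1mx.
by rewrite opinionsS mulmxA pP.
Qed.

Lemma invariant_cycle_mx x p i0 :
  p^T *m cycle_mx x = p^T -> forall i, p i 0 * x i = p i0 0 * x i0.
Proof.
move=> px; apply: (@ordS_ind _ _ i0) => // i <-.
have := trmx_mul_cycle_mxE x i p; rewrite px mxE; lra.
Qed.

Lemma cycle_mx_invariant x p c :
  (forall i, p i 0 * x i = c) -> p^T *m cycle_mx x = p^T.
Proof.
move=> px; apply/matrixP => a b; rewrite (ord1 a).
have -> : b = ordS (ord_pred b) by rewrite ord_predK.
rewrite trmx_mul_cycle_mxE px mulrBr mulr1 px mxE; lra.
Qed.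

(* With [c = p i * x i] constant, the Dirichlet form is exactly the decrease of
   the energy, since the sums of the squares of [s i] and [s (i + 1)] agree. *)
Lemma energy_decrease x p c s :
  (forall i, p i 0 * x i = c) ->
  \sum_i p i 0 * s i 0 ^+ 2 - \sum_i p i 0 * (cycle_mx x *m s) i 0 ^+ 2
  = \sum_i c * (1 - x i) * (s i 0 - s (ordS i) 0) ^+ 2.
Proof.
move=> px.
have shift : \sum_i c * s (ordS i) 0 ^+ 2 = \sum_i c * s i 0 ^+ 2.
  by rewrite [RHS](reindex_inj (@ordS_inj n)).
apply: (@addIr _ (\sum_i c * s (ordS i) 0 ^+ 2)); rewrite {2}shift.
rewrite -sumrB -!big_split; apply: eq_bigr => i _ /=.
rewrite cycle_mxE -(px i); lra.
Qed.

(** All summands of the energy drop are nonnegative, so the square of one difference is at most the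
    drop divided by [c * (1 - x i)], which is positive as [x i < 1]. *)
Lemma cvg_sub_next x p c s i :
  (forall i, 0 < p i 0) -> (forall i, p i 0 * x i = c) -> 0 < c ->
  (forall i, x i < 1) ->
  opinions (cycle_mx x) s k i 0 - opinions (cycle_mx x) s k (ordS i) 0
    @[k --> \oo] --> (0 : R).
Proof.
move=> p0 px c0 x1; pose u k := opinions (cycle_mx x) s k.
pose V k := \sum_i p i 0 * u k i 0 ^+ 2.
have V0 k : 0 <= V k.
  by apply: sumr_ge0 => j _; rewrite mulr_ge0 ?sqr_ge0 // ltW.
have decV k : V k - V k.+1
    = \sum_i c * (1 - x i) * (u k i 0 - u k (ordS i) 0) ^+ 2.
  by rewrite -(energy_decrease (u k) px) /V /u opinionsS.
have term0 k j : 0 <= c * (1 - x j) * (u k j 0 - u k (ordS j) 0) ^+ 2.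
  by rewrite mulr_ge0 ?sqr_ge0 // mulr_ge0 ?subr_ge0 ?(ltW c0) // ltW.
have cvgV : cvgn V.
  apply: nonincreasing_is_cvgn; last by exists 0 => _ [k _ <-].
  apply/nonincreasing_seqP => k; rewrite -subr_ge0 decV.
  by apply: sumr_ge0 => j _; exact: term0.
have cvgdV : (c * (1 - x i))^-1 * (V k - V k.+1) @[k --> \oo] --> (0 : R).
  rewrite -[X in _ --> X](mulr0 (c * (1 - x i))^-1).
  apply: cvgM; first exact: cvg_cst.
  rewrite -(subrr (limn V)); apply: cvgB => //.
  by rewrite (cvg_shiftS V).
(* The squeeze bounds squares; continuity of the square root at 0 passes to absolute values. *)
apply: norm_cvg0.
rewrite -[X in _ --> X](@sqrtr0 R).
under eq_fun do rewrite -sqrtr_sqr.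
apply: (continuous_cvg _ (@sqrt_continuous R 0)).
apply: (squeeze_cvgr _ (cvg_cst 0) cvgdV); near=> k.
have cx0 : 0 < c * (1 - x i) by rewrite mulr_gt0 // subr_gt0.
rewrite sqr_ge0 /= mulrC ler_pdivlMr // mulrC decV (bigD1 i) //= lerDl.
by apply: sumr_ge0 => j _; exact: term0.
Unshelve. all: by end_near. Qed.

Lemma cycle_mx_consensus x p c :
  positive_probability_vector p -> (forall i, p i 0 * x i = c) -> 0 < c ->
  (forall i, x i < 1) -> implements_consensus (cycle_mx x) p.
Proof.
move=> [p0 p1] px c0 x1 s i; pose u k := opinions (cycle_mx x) s k.
(* Consecutive differences telescope along the cycle, starting from [i]. *)
have diff j : u k i 0 - u k j 0 @[k --> \oo] --> (0 : R).
  move: j; apply: (@ordS_ind _ _ i) => [|j IHj].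
    by under eq_fun do rewrite subrr; exact: cvg_cst.
  have split k : u k i 0 - u k (ordS j) 0
      = (u k i 0 - u k j 0) + (u k j 0 - u k (ordS j) 0) by lra.
  rewrite -[X in _ --> X]addr0; under eq_fun do rewrite split.
  by apply: cvgD => //; exact: (cvg_sub_next s j p0 px c0 x1).
rewrite -[X in _ --> X]add0r.
(* As [p] sums to 1, an opinion is the conserved mean plus the [p]-average of its differences to all
   opinions. *)
have uE k : u k i 0 = \sum_j p j 0 * (u k i 0 - u k j 0) + (p^T *m s) 0 0.
  rewrite -(invariant_opinions s k (cycle_mx_invariant px)).
  rewrite [X in _ + X]mxE -big_split /=.
  under eq_bigr do rewrite [p^T _ _]mxE -mulrDr subrK.
  by rewrite -mulr_suml p1 mul1r.
under eq_fun do rewrite uE.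
apply: cvgD; last exact: cvg_cst.
rewrite [X in _ --> X](_ : _ = \sum_(j < n) p j 0 * 0); last first.
  by rewrite big1 // => j _; rewrite mulr0.
apply: cvg_big => [|j _]; first exact: add_continuous.
by apply: cvgM => //; exact: cvg_cst.
Qed.

Lemma cycle_mx_row_stochastic x :
  (forall i, 0 <= x i <= 1) -> row_stochastic (cycle_mx x).
Proof.
move=> x01; split=> i.
  move=> j; have /andP[x0 x1] := x01 i.
  by rewrite mxE addr_ge0 // mulrn_wge0 // subr_ge0.
(* A row sum is the value on the all-ones vector. *)
have := cycle_mxE x (const_mx 1) i; rewrite !mxE !mulr1 subrK => <-.
by apply: eq_bigr => j _; rewrite [const_mx _ _ _]mxE mulr1.
Qed.

(** As [i] and [ordS i] differ for [1 < n], the row sum forces the diagonal entry to be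
    [1 - P i (ordS i)]. *)
Lemma row_stochastic_cycle_mx P :
  (1 < n)%N -> row_stochastic P ->
  (forall i j, j != i -> j != ordS i -> P i j = 0) ->
  P = cycle_mx (fun i => P i (ordS i)).
Proof.
move=> n1 [_ sumP] P0; apply/matrixP => i j; rewrite mxE.
have [->|ji] := eqVneq j i.
  rewrite eq_sym (negbTE (ordS_neq i n1)) addr0 mulr1n -(sumP i).
  rewrite (bigD1 i) //= (bigD1 (ordS i)) ?ordS_neq //= big1 ?addr0 ?addrK //.
  by move=> k /andP[ki kSi]; exact: P0.
have [->|jSi] := eqVneq j (ordS i); first by rewrite add0r.
by rewrite P0 ?addr0.
Qed.

End CycleMatrix.

Theorem proposition1 (R : realType) (n : nat) (hn : (2 <= n)%N)
    (p : 'cV[R]_n) (hp : positive_probability_vector p) :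
  exists F : set (wdigraph R n),
    [/\ F !=set0,
        forall H : wdigraph R n, F H <->
          hamiltonian_cycle_with_loops H /\
          exists P : 'M[R]_n,
            [/\ row_stochastic P,
                communication_digraph P H
              & implements_consensus P p]
      & forall H : wdigraph R n, F H ->
          exists2 c : R, 0 < c &
            forall j k : 'I_n, j != k -> has_arc H j k ->
              arc_weight H j k = c * (p k 0)^-1].
Proof.
have [p0 p1] := hp.
pose i0 : 'I_n := Ordinal (ltnW hn).
exists [set H | hamiltonian_cycle_with_loops H /\
  exists P : 'M[R]_n, [/\ row_stochastic P, communication_digraph P H
    & implements_consensus P p]]; split=> //.
- pose m := p [arg min_(i < i0) p i 0]%O 0.
  have m_le i : m <= p i 0 by rewrite /m; case: arg_minP => // a _; apply.
  have m0 : 0 < m by exact: p0.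
  (* Half the minimum makes every [x i] at most 1/2, so all loops have positive weight. *)
  pose c := m / 2; pose x i := c / p i 0.
  have c0 : 0 < c by rewrite divr_gt0.
  have px i : p i 0 * x i = c by rewrite mulrC divfK // gt_eqF.
  have x0 i : 0 < x i by rewrite divr_gt0.
  have x1 i : x i < 1.
    by rewrite ltr_pdivrMr // mul1r; have := m_le i; rewrite /c; lra.
  pose P := cycle_mx x.
  have Pgt0 i j : (0 < P i j) = (j == i) || (j == ordS i).
    rewrite mxE; have [->|_] := eqVneq j i.
      by rewrite ltr_wpDr ?subr_gt0 // mulrn_wge0 // ltW.
    by case: (j == ordS i); rewrite add0r ?x0 ?ltxx.
  exists (WDigraph (fun j i => 0 < P i j) (fun j i => P i j)); split.
    split=> //= [j i ji|]; first by rewrite Pgt0 (negbTE ji) ordS_eqE.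
    by exists i0; rewrite Pgt0 eqxx.
  exists P; split=> //; first by apply: cycle_mx_row_stochastic => i; rewrite !ltW.
  exact: (cycle_mx_consensus hp px c0 x1).
- move=> H [[_ arcE _] [P [stP [arcP weightP] consP]]].
  have arcS j i : j != i -> has_arc H j i = (j == ordS i).
    by move=> ji; rewrite arcE // ordS_eqE.
  have P0 i j : j != i -> j != ordS i -> P i j = 0.
    move=> ji jSi; apply/eqP; rewrite eq_le stP.1 andbT leNgt -arcP arcS //.
  have invP := implements_consensus_invariant consP.
  rewrite (row_stochastic_cycle_mx hn stP P0) in invP.
  (* By invariance this product is the same at every vertex; the arc entering [i0] makes it
     positive. *)
  exists (p i0 0 * P i0 (ordS i0)).
    by rewrite mulr_gt0 // -arcP arcS ?ordS_neq.
  move=> j k jk Hjk; rewrite weightP //.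
  move: Hjk; rewrite arcS // => /eqP ->.
  by rewrite -(invariant_cycle_mx i0 invP k) mulrAC divff ?mul1r // gt_eqF.
Qed.
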